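(* Let $\bar R\in(0,\infty)$ and $\Lambda\in(0,\infty)$. Then there is a constant $N=N(\underline R,\bar R,\Lambda,\bar\xi)$ such that for any $R\in(0,\bar R]$ and $\lambda\in[0,\Lambda]$ $$N\,E\tau_R\ge R^2,\qquad N\,E\int_0^{\tau_R}e^{-\lambda t}\,dt\ge R^2.$$
   Context: Let $d\ge2$, $\delta\in(0,1)$, $p_0,q_0\in[1,\infty)$ with $d/p_0+1/q_0=1$; $\mathbb{S}_\delta$ is the set of symmetric $d\times d$ matrices with eigenvalues in $[\delta,\delta^{-1}]$. Sets: $B_R=\{x\in\mathbb{R}^d:|x|<R\}$, $C_{T,R}=[0,T)\times B_R$, $C_R(t,x)=(t,x)+C_{R^2,R}$. Mixed norms: for $p,q\in[1,\infty]$ and a domain $Q\subset\mathbb{R}^{d+1}=\{(t,x)\}$, $\|f\|^q_{L_{p,q}(Q)}=\int_{\mathbb{R}}\big(\int_{\mathbb{R}^d}I_Q|f(t,x)|^p\,dx\big)^{q/p}dt$ if $p\ge q$, and $\|f\|^p_{L_{p,q}(Q)}=\int_{\mathbb{R}^d}\big(\int_{\mathbb{R}}I_Q|f(t,x)|^q\,dt\big)^{p/q}dx$ if $p\le q$. Process: $(\Omega,\mathcal{F},P)$ is a complete probability space, $\mathcal{F}_t$, $t\ge0$, an increasing family of complete $\sigma$-fields, $w_t$ an $\mathbb{R}^d$-valued Wiener process relative to $\mathcal{F}_t$, $\sigma_t$ an $\mathbb{S}_\delta$-valued $\mathcal{F}_t$-adapted process, $b_t$ an $\mathbb{R}^d$-valued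 $\mathcal{F}_t$-adapted process with $\int_0^T|b_t|dt<\infty$ for all $T$ and $\omega$, and $x_t=\int_0^t\sigma_s\,dw_s+\int_0^tb_s\,ds$. Standing assumption (A): there are a (Borel, nonnegative) function $h\in L_{p_0,q_0,\mathrm{loc}}$ on $\mathbb{R}^{d+1}$ with $|b_t|\le h(t,x_t)$, and a bounded nondecreasing function $\bar b_R$, $R\in(0,\infty)$, with $\|h\|^{q_0}_{L_{p_0,q_0}(C_R(t,x))}\le\bar b_RR$ for all $(t,x)\in\mathbb{R}^{d+1}$, $R\in(0,\infty)$. Exit times: $\tau_{T,R}(x)=\inf\{t\ge0:(t,x+x_t)\notin C_{T,R}\}$, $\tau_R(x)=\tau_{R^2,R}(x)$, $\tau_R=\tau_R(0)$, $\tau'_R(x)=\inf\{t\ge0:x+x_t\notin B_R\}$, $\gamma_R(x)=\inf\{t\ge0:x+x_t\in\bar B_R\}$. Constants $\bar\xi,\bar N,\underline R$: $\bar\xi=\bar\xi(d,\delta)\in(0,1)$ and $\bar N=\bar N(d,p_0,\delta)$ are fixed constants (they exist), continuous in $\delta$, such that for every process satisfying (A) and every $R$ with $\bar N\bar b_R\le1$: for $|x|\le R$, $n\ge1$, $P(\tau_R(x)=R^2)\le1-\bar\xi$, $P(\tau_R=R^2)\ge\bar\xi$, $P(\tau'_R(x)\ge nR^2)\le(1-\bar\xi)^n$, $E\tau'_R(x)\le N(d,\delta)R^2$, $E\int_0^{\tau'_R(x)}h(t,x_t)dt\le N(d,p_0,\delta)(1+\bar b_R)^{d/p_0}\bar b_R^{1/q_0}R$;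 and $P(\tau'_R(x)>\gamma_{R/16}(x))\ge\bar\xi$ for $|x|\le 9R/16$. Standing assumption (B): there is $\underline R\in(0,\infty)$, fixed, with $\bar N\bar b_{\underline R}<1$. $N(\cdots)$ denotes a constant depending only on the listed arguments. *)

(* Defs.v *)
From HB Require Import structures.
From mathcomp Require Import all_boot all_order all_algebra.
From mathcomp Require Import all_classical all_reals all_analysis.

Set Implicit Arguments.
Unset Strict Implicit.
Unset Printing Implicit Defensive.

Import Order.TTheory GRing.Theory Num.Theory.
Import numFieldNormedType.Exports.

Local Open Scope classical_set_scope.
Local Open Scope ring_scope.

(* The library norm on matrices is the sup norm; the balls below are
   Euclidean. *)
Definition enorm {R : realType} {d : nat} (x : 'cV[R]_d) : R :=
  Num.sqrt (\sum_(i < d) x i 0 ^+ 2).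

Definition eball {R : realType} {d : nat} (r : R) : set 'cV[R]_d :=
  [set x | enorm x < r].

Definition eclosed_ball {R : realType} {d : nat} (r : R) : set 'cV[R]_d :=
  [set x | enorm x <= r].

Definition cyl {R : realType} {d : nat} (T r : R) : set (R * 'cV[R]_d) :=
  [set z | 0 <= z.1 < T /\ eball r z.2].

Definition cyl_at {R : realType} {d : nat} (r t : R) (x : 'cV[R]_d) :
    set (R * 'cV[R]_d) :=
  [set z | cyl (r ^+ 2) r (z.1 - t, z.2 - x)].

(* Lebesgue integral over R^d written as an iterated integral; it is only
   applied to nonnegative Borel functions, for which Tonelli's theorem
   identifies it with the integral against d-dimensional Lebesgue measure. *)
Fixpoint integral_Rd {R : realType} (d : nat) :
    ('cV[R]_d -> \bar R) -> \bar R :=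
  match d with
  | 0 => fun f => f 0
  | d'.+1 => fun f =>
      (\int[lebesgue_measure]_(r in [set: R])
         integral_Rd (fun y : 'cV[R]_d' =>
           f (col_mx (r%:M : 'cV[R]_1) y : 'cV[R]_(1 + d'))))%E
  end.

(* Only finite exponents are needed.  For q <= p the space integral is the
   inner one, for p < q the time integral is. *)
Definition mixed_norm {R : realType} {d : nat} (p q : R)
    (Q : set (R * 'cV[R]_d)) (f : R -> 'cV[R]_d -> R) : \bar R :=
  (if (q <= p)%R then
     (\int[lebesgue_measure]_(t in [set: R])
        (integral_Rd (fun x => ((\1_Q (t, x) * `|f t x|) `^ p)%:E))
          `^ (q / p)) `^ q^-1
   else
     (integral_Rd (fun x =>
        (\int[lebesgue_measure]_(t in [set: R])
           ((\1_Q (t, x) * `|f t x|) `^ q)%:E) `^ (p / q))) `^ p^-1)%E.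

Definition mixed_norm_loc {R : realType} {d : nat} (p q : R)
    (f : R -> 'cV[R]_d -> R) : Prop :=
  forall r : R, 0 < r ->
    (mixed_norm p q [set z | (`|z.1| < r)%R /\ eball r z.2] f < +oo)%E.

Definition borel_fun {R : realType} {d : nat} (h : R -> 'cV[R]_d -> R) :
    Prop :=
  forall B : set R, measurable B ->
    <<s (@open (R * 'cV[R]_d)%type) >> ((fun z => h z.1 z.2) @^-1` B).

Definition sym_spectrum {R : realType} {d : nat} (delta : R) (A : 'M[R]_d) :
    Prop :=
  A^T = A /\ (forall a : R, eigenvalue A a -> delta <= a <= delta^-1).

Section processes.
Context {R : realType} {dd : measure_display} {Omega : measurableType dd}
        (P : probability Omega R).

(* Completeness of F t is understood relative to P: every P-null set of the
   ambient sigma-field belongs to F t. *)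
Record complete_filtration (F : R -> set_system Omega) : Prop := {
  filtration_sigma : forall t, 0 <= t -> sigma_algebra setT (F t) ;
  filtration_sub : forall t, 0 <= t -> F t `<=` measurable ;
  filtration_null : forall t A, 0 <= t -> P.-negligible A -> F t A ;
  filtration_le : forall s t, 0 <= s -> s <= t -> F s `<=` F t }.

Definition measurable_wrt (G : set_system Omega) (f : Omega -> R) : Prop :=
  preimage_set_system setT f measurable `<=` G.

Definition adapted (F : R -> set_system Omega) {m n : nat}
    (X : R -> Omega -> 'M[R]_(m, n)) : Prop :=
  forall t i j, 0 <= t -> measurable_wrt (F t) (fun w => X t w i j).

Definition jointly_measurable {m n : nat} (X : R -> Omega -> 'M[R]_(m, n)) :
    Prop :=
  forall i j, measurable_fun
    [set z : measurableTypeR R * Omega | 0 <= (z.1 : R)]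
    (fun z : measurableTypeR R * Omega => X z.1 z.2 i j).

Definition continuous_paths {m n : nat} (X : R -> Omega -> 'M[R]_(m, n)) :
    Prop :=
  forall w, {within [set t : R | 0 <= t], continuous (fun t => X t w)}.

(* The increment over [s, t] is independent of F s, with independent
   N(0, t - s) coordinates; normal_prob takes the standard deviation. *)
Record wiener (F : R -> set_system Omega) {d : nat}
    (W : R -> Omega -> 'cV[R]_d) : Prop := {
  wiener0 : forall w, W 0 w = 0 ;
  wiener_continuous : continuous_paths W ;
  wiener_adapted : adapted F W ;
  wiener_increments : forall (s t : R) (A : set Omega) (B : 'I_d -> set R),
    0 <= s -> s < t -> F s A -> (forall i, measurable (B i)) ->
    P (A `&` [set w | forall i, B i (W t w i 0 - W s w i 0)]) =
    (P A * \big[*%E/1]_(i < d) normal_prob 0 (Num.sqrt (t - s)) (B i))%E }.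

(* A simple integrand: the value step_val i on
   [step_time i, step_time i.+1), for i < step_size. *)
Record step_process (d : nat) := StepProcess {
  step_size : nat ;
  step_time : nat -> R ;
  step_val : nat -> Omega -> 'M[R]_d }.

Definition step_admissible (F : R -> set_system Omega) {d : nat}
    (phi : step_process d) : Prop :=
  0 <= step_time phi 0 /\
  forall i, (i < step_size phi)%N ->
    [/\ step_time phi i <= step_time phi i.+1,
        forall k l, measurable_wrt (F (step_time phi i))
                      (fun w => step_val phi i w k l) &
        exists C : R, forall w k l, `|step_val phi i w k l| <= C].

Definition step_eval {d : nat} (phi : step_process d) (t : R) (w : Omega) :
    'M[R]_d :=
  \sum_(i < step_size phi | step_time phi i <= t < step_time phi i.+1)
     step_val phi i w.

Definition step_integral {d : nat} (phi : step_process d)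
    (W : R -> Omega -> 'cV[R]_d) (t : R) (w : Omega) : 'cV[R]_d :=
  \sum_(i < step_size phi)
     step_val phi i w *m (W (Num.min (step_time phi i.+1) t) w
                          - W (Num.min (step_time phi i) t) w).

(* M is the continuous version of the Ito integral of sigma with respect to
   W, for E int_0^T |sigma|^2 dt < oo: the L^2 limit of integrals of simple
   processes approximating sigma in L^2([0, T] x Omega) for every T. *)
Definition ito_integral (F : R -> set_system Omega) {d : nat}
    (W : R -> Omega -> 'cV[R]_d) (sigma : R -> Omega -> 'M[R]_d)
    (M : R -> Omega -> 'cV[R]_d) : Prop :=
  [/\ adapted F M, continuous_paths M &
      exists phi : nat -> step_process d,
      [/\ forall n, step_admissible F (phi n),
          forall T : R, 0 <= T ->
            (\int[P]_w \int[lebesgue_measure]_(t in `[0%R, T])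
               (\sum_(k < d) \sum_(l < d)
                  (step_eval (phi n) t w k l - sigma t w k l) ^+ 2)%R%:E)%E
              @[n --> \oo] --> 0%E &
          forall t : R, 0 <= t ->
            (\int[P]_w (enorm (step_integral (phi n) W t w - M t w)%R ^+ 2)%:E)%E
              @[n --> \oo] --> 0%E]].

Record diffusion {d : nat} (delta : R) (F : R -> set_system Omega)
    (W : R -> Omega -> 'cV[R]_d) (sigma : R -> Omega -> 'M[R]_d)
    (b X : R -> Omega -> 'cV[R]_d) : Prop := {
  diffusion_complete : measure_is_complete P ;
  diffusion_filtration : complete_filtration F ;
  diffusion_wiener : wiener F W ;
  diffusion_sigma_spectrum :
    forall t w, 0 <= t -> sym_spectrum delta (sigma t w) ;
  diffusion_sigma_adapted : adapted F sigma ;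
  diffusion_sigma_measurable : jointly_measurable sigma ;
  diffusion_drift_adapted : adapted F b ;
  diffusion_drift_measurable : jointly_measurable b ;
  diffusion_drift_integrable : forall (T : R) w, 0 <= T ->
    (\int[lebesgue_measure]_(t in `[0%R, T]) (enorm (b t w))%:E < +oo)%E ;
  diffusion_eq : exists2 M, ito_integral F W sigma M &
    forall t w, 0 <= t ->
      X t w = M t w +
        \col_i (\int[lebesgue_measure]_(s in `[0, t]) (b s w i 0)) }.

End processes.

Record drift_bound {R : realType} {Omega : Type} {d : nat} (p0 q0 : R)
    (b X : R -> Omega -> 'cV[R]_d) (h : R -> 'cV[R]_d -> R) (bbar : R -> R) :
    Prop := {
  drift_bound_borel : borel_fun h ;
  drift_bound_ge0 : forall t x, 0 <= h t x ;
  drift_bound_loc : mixed_norm_loc p0 q0 h ;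
  drift_bound_le : forall t w, 0 <= t -> enorm (b t w) <= h t (X t w) ;
  drift_bound_bounded : exists C : R, forall r, 0 < r -> `|bbar r| <= C ;
  drift_bound_nondecreasing :
    forall r s, 0 < r -> r <= s -> bbar r <= bbar s ;
  drift_bound_norm : forall r t x, 0 < r ->
    (mixed_norm p0 q0 (cyl_at r t x) h `^ q0 <= (bbar r * r)%:E)%E }.

Section exit_times.
Context {R : realType} {Omega : Type} {d : nat}.
Variable X : R -> Omega -> 'cV[R]_d.

(* Infima are taken in the extended reals, so that inf of the empty set is
   +oo. *)
Definition exit_cyl (T r : R) (x : 'cV[R]_d) (w : Omega) : \bar R :=
  ereal_inf [set t%:E | t in [set t : R | 0 <= t /\
    ~ cyl T r (t, x + X t w)]].

Definition tau (r : R) (x : 'cV[R]_d) (w : Omega) : \bar R :=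
  exit_cyl (r ^+ 2) r x w.

Definition tau' (r : R) (x : 'cV[R]_d) (w : Omega) : \bar R :=
  ereal_inf [set t%:E | t in [set t : R | 0 <= t /\
    ~ eball r (x + X t w)]].

Definition gamma (r : R) (x : 'cV[R]_d) (w : Omega) : \bar R :=
  ereal_inf [set t%:E | t in [set t : R | 0 <= t /\
    eclosed_ball r (x + X t w)]].

End exit_times.

(* Integral of a function of time from 0 to a possibly infinite time s. *)
Definition integral_upto {R : realType} (s : \bar R) (f : R -> R) : \bar R :=
  (\int[lebesgue_measure]_(t in [set t : R | (0 <= t)%R /\ t%:E < s])
     (f t)%:E)%E.

Definition admissible_parameters {R : realType} (d : nat) (delta p0 q0 : R) :
    Prop :=
  [/\ (2 <= d)%N, 0 < delta < 1, 1 <= p0, 1 <= q0 &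
      d%:R / p0 + q0^-1 = 1].

(* The estimates satisfied by xi = xibar(d, delta) for a given process and a
   given radius r; N1 and N2 stand for N(d, delta) and N(d, p0, delta). *)
Record exit_estimates {R : realType} {dd : measure_display}
    {Omega : measurableType dd} (P : probability Omega R) {d : nat}
    (p0 q0 xi N1 N2 : R) (X : R -> Omega -> 'cV[R]_d)
    (h : R -> 'cV[R]_d -> R) (bbar : R -> R) (r : R) : Prop := {
  exit_tau_le : forall x : 'cV[R]_d, enorm x <= r ->
    (P [set w | tau X r x w = (r ^+ 2)%:E] <= (1 - xi)%:E)%E ;
  exit_tau_ge :
    (xi%:E <= P [set w | tau X r 0 w = (r ^+ 2)%:E])%E ;
  exit_tau'_tail : forall (x : 'cV[R]_d) (n : nat), enorm x <= r ->
    (1 <= n)%N ->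
    (P [set w | ((n%:R * r ^+ 2)%:E <= tau' X r x w)%E]
       <= ((1 - xi) ^+ n)%:E)%E ;
  exit_tau'_mean : forall x : 'cV[R]_d, enorm x <= r ->
    (\int[P]_w tau' X r x w <= (N1 * r ^+ 2)%:E)%E ;
  exit_tau'_drift : forall x : 'cV[R]_d, enorm x <= r ->
    (\int[P]_w integral_upto (tau' X r x w) (fun t => h t (X t w))
       <= (N2 * (1 + bbar r) `^ (d%:R / p0) * bbar r `^ q0^-1 * r)%:E)%E ;
  exit_hit : forall x : 'cV[R]_d, enorm x <= 9 * r / 16 ->
    (xi%:E <= P [set w | (gamma X (r / 16) x w < tau' X r x w)%E])%E }.

(* xibar(d, delta) and Nbar(d, p0, delta) are constants of the kind fixed
   once and for all in the theory.  The sample space ranges over all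
   probability spaces. *)
Definition universal_constants {R : realType} (xibar : nat -> R -> R)
    (Nbar : nat -> R -> R -> R) : Prop :=
  [/\ forall d delta, (2 <= d)%N -> 0 < delta < 1 -> 0 < xibar d delta < 1,
      forall d, (2 <= d)%N -> {in `]0, 1[, continuous (xibar d)},
      forall d delta p0 q0, admissible_parameters d delta p0 q0 ->
        {in `]0, 1[, continuous (Nbar d p0)} &
      exists (N1 : nat -> R -> R) (N2 : nat -> R -> R -> R),
        forall (d : nat) (delta p0 q0 : R) (dd : measure_display)
          (Omega : measurableType dd) (P : probability Omega R)
          (F : R -> set_system Omega) (W : R -> Omega -> 'cV[R]_d)
          (sigma : R -> Omega -> 'M[R]_d) (b X : R -> Omega -> 'cV[R]_d)
          (h : R -> 'cV[R]_d -> R) (bbar : R -> R),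
        admissible_parameters d delta p0 q0 ->
        diffusion P delta F W sigma b X ->
        drift_bound p0 q0 b X h bbar ->
        forall r : R, 0 < r -> Nbar d p0 delta * bbar r <= 1 ->
          exit_estimates P p0 q0 (xibar d delta) (N1 d delta)
            (N2 d p0 delta) X h bbar r].

(* Main.v *)
Require Import Defs.
From HB Require Import structures.
From mathcomp Require Import all_boot all_order all_algebra.
From mathcomp Require Import all_classical all_reals all_analysis.
From mathcomp Require Import measurable_realfun ring.

Import Order.TTheory GRing.Theory Num.Theory.
Import numFieldNormedType.Exports.

Local Open Scope classical_set_scope.
Local Open Scope ring_scope.

(** If the process stays in the smaller cylinder of radius s = min (r, Rlow) up
    to time s ^+ 2, then the exit time tau_r is at least s ^+ 2.  The radius s
    is one at which Nbar * bbar s <= 1 holds, because bbar is nondecreasing and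
    nonnegative, so the event tau_s = s ^+ 2 has probability at least xi.  A
    random variable that is at least c on this event has expectation at least
    c * xi; for tau_r one takes c = s ^+ 2, for the discounted integral one takes
    c = exp (- lambda * s ^+ 2) * s ^+ 2, and both are at least
    exp (- Lambda * Rbar ^+ 2) * s ^+ 2.  Finally r <= (1 + Rbar / Rlow) * s, so
    that N = (1 + Rbar / Rlow) ^+ 2 * exp (Lambda * Rbar ^+ 2) / xi works.

    The expectation bound ([ge0_le_integral_set]) compares the random variable
    with a simple function below it, a multiple of the indicator of the event,
    so the point to settle is that the event is measurable.  The event says that the
    squared Euclidean norm of the path is less than s ^+ 2 on the interval
    [0, s ^+ 2[ ([tau_eq_sqr]).  For a continuous path this is a countable
    condition ([measurable_forall_lt]).  The coordinates of the process are
    continuous and measurable because the stochastic integral is so by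
    definition, and the drift integral is so by integrability of the drift and
    by Tonelli's theorem. *)

(** * Lower bounds for integrals of possibly nonmeasurable functions *)

(** The integral of a nonnegative function is the supremum of the integrals of
    the simple functions below it, so it is monotone on all such functions,
    measurable or not. *)
Lemma ge0_le_integral_pointwise {dd : measure_display} {T : measurableType dd}
    {R : realType} (mu : {measure set T -> \bar R}) (f g : T -> \bar R) :
  (forall x, 0 <= f x)%E -> (forall x, f x <= g x)%E ->
  (\int[mu]_x f x <= \int[mu]_x g x)%E.
Proof.
move=> f0 fg; rewrite !ge0_integralTE//; last first.
  by move=> x; exact: le_trans (fg x).
by apply: ereal_sup_le => _ [h hf <-]; exists h => // x; exact: le_trans (fg x).
Qed.

Lemma ge0_le_integral_set {dd : measure_display} {T : measurableType dd}
    {R : realType} {mu : {measure set T -> \bar R}} {D : set T} {c : R}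
    {f : T -> \bar R} :
  measurable D -> 0 <= c -> (forall x, 0 <= f x)%E ->
  (forall x, D x -> c%:E <= f x)%E -> (c%:E * mu D <= \int[mu]_x f x)%E.
Proof.
move=> mD c0 f0 cf; rewrite -integral_cst// integral_mkcond.
apply: ge0_le_integral_pointwise => x; rewrite patchE; case: ifPn => //.
by rewrite inE; exact: cf.
Qed.

(** * Measurability of events along continuous paths *)

(** By compactness, a continuous path is less than c on [0, T[ if and only if
    on each smaller interval [0, T - 1 / (n + 1)] it is at most some
    c - 1 / (m + 1), and by continuity the latter may be tested at rational
    times.  The margin 1 / (m + 1) is needed because a path that is less than c
    at all rational times may still touch c. *)
Lemma measurable_forall_lt {dd : measure_display} {Omega : measurableType dd}
    {R : realType} (Y : R -> Omega -> R) (T c : R) :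
  (forall t, 0 <= t -> measurable_fun [set: Omega] (Y t)) ->
  (forall w, {within `[0, T], continuous (fun t => Y t w)}) ->
  measurable [set w | forall t, 0 <= t < T -> Y t w < c].
Proof.
move=> mY cY.
(* q enumerates the rationals; junk codes are sent to 0. *)
pose q k : R := ratr (odflt 0 (unpickle k)).
pose tn n : R := T - n.+1%:R^-1.
pose cm m : R := c - m.+1%:R^-1.
rewrite (_ : [set w | _] = \bigcap_n \bigcup_m \bigcap_k
    [set w | 0 <= q k <= tn n -> Y (q k) w <= cm m]); last first.
  apply/seteqP; split => w /=.
  - move=> Yc n _; have [tn0|tn0] := ltP (tn n) 0.
      exists 0%N => // k _ /= /andP[q0 qt].
      by have := le_lt_trans (le_trans q0 qt) tn0; rewrite ltxx.
    have tnT : tn n < T by rewrite /tn ltrBlDr ltrDl invr_gt0.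
    have cYn : {within `[0, tn n], continuous (fun t => Y t w)}.
      apply: continuous_subspaceW (cY w) => t /=; rewrite !in_itv/=.
      by move=> /andP[-> /le_trans->//]; exact: ltW.
    have [u] := EVT_max tn0 cYn; rewrite in_itv/= => /andP[u0 un] umax.
    have [m um] := ltr_add_invr (Yc u (introT andP (conj u0 (le_lt_trans un tnT)))).
    exists m => // k _ /= qk.
    apply: le_trans (umax _ _) _; first by rewrite in_itv.
    by rewrite /cm lerBrDr ltW.
  - move=> Yc t /andP[t0 tT]; have [n tnT] := ltr_add_invr tT.
    have {}tnT : t < tn n by rewrite /tn ltrBrDr.
    have [m _ Ym] := Yc n I; rewrite ltNge; apply/negP => cYt.
    have /subspace_continuousP/(_ t) := cY w.
    have tI : `[0, T]%classic t by rewrite /= in_itv/= t0 ltW.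
    have m0 : (0 : R) < m.+1%:R^-1 by rewrite invr_gt0.
    move=> /(_ tI) /cvgrPdist_lt /(_ _ m0) [e /= e0 He].
    have /rat_in_itvoo[j] : t < Num.min (t + e) (tn n).
      by rewrite lt_min tnT ltrDl e0.
    rewrite in_itv/= lt_min => /andP[tj /andP[je jn]].
    have jT : ratr j <= T.
      by apply: le_trans (ltW jn) _; rewrite /tn lerBlDr lerDl.
    have jI : 0 <= (ratr j : R) <= T by rewrite (le_trans t0 (ltW tj)).
    have tje : `|t - ratr j| < e.
      by rewrite ltr0_norm ?subr_lt0// opprB ltrBlDl.
    have {He tje}Hj : `|Y t w - Y (ratr j) w| < m.+1%:R^-1.
      by have /= := He _ tje; rewrite in_itv/=; apply.
    have /= := Ym (pickle j) I; rewrite /q pickleK/=.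
    rewrite (le_trans t0 (ltW tj)) (ltW jn) => /(_ isT) Yj; move: Hj.
    rewrite ltr_norml => /andP[_]; apply/negP; rewrite -leNgt.
    by rewrite lerBrDl -lerBrDr (le_trans Yj)// lerB.
apply: bigcap_measurableType => n _; apply: bigcup_measurable => m _.
apply: bigcap_measurableType => k _.
have [qk|qk] := boolP (0 <= q k <= tn n).
  rewrite (_ : [set w | _] = [set: Omega] `&` (Y (q k)) @^-1` `]-oo, cm m]).
    by apply: mY => //; case/andP: qk.
  by apply/seteqP; split => w /=; rewrite in_itv/=; [move=> /(_ isT)|case].
by rewrite (_ : [set w | _] = [set: Omega])//; apply/seteqP; split.
Qed.

Lemma measurable_nonneg_time {dd : measure_display}
    {Omega : measurableType dd} {R : realType} :
  measurable [set z : measurableTypeR R * Omega | 0 <= (z.1 : R)].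
Proof.
rewrite (_ : [set _ | _] = (`[0, +oo[ : set R) `*` [set: Omega]).
  by apply: measurableX => //; exact: measurable_itv.
by apply/seteqP; split => -[s w] /=; rewrite in_itv/= andbT; [|case].
Qed.

(** Tonelli's theorem gives the measurability in w of the integrals of the
    positive and of the negative part, whether or not they are finite, and the
    integral of f (., w) is the real part of their difference. *)
Lemma measurable_time_integral {dd : measure_display}
    {Omega : measurableType dd} {R : realType} (t : R) (f : R * Omega -> R) :
  measurable_fun [set z : measurableTypeR R * Omega | 0 <= (z.1 : R)]
    (f : measurableTypeR R * Omega -> R) ->
  measurable_fun [set: Omega]
    (fun w => \int[lebesgue_measure]_(s in `[0, t]) f (s, w)).
Proof.
move=> mf.
pose D := [set z : measurableTypeR R * Omega | 0 <= (z.1 : R) <= t].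
pose g : measurableTypeR R * Omega -> \bar R := (EFin \o (f : measurableTypeR R * Omega -> R)) \_ D.
have mD : measurable D.
  rewrite (_ : D = (`[0, t] : set R) `*` [set: Omega]).
    by apply: measurableX => //; exact: measurable_itv.
  by apply/seteqP; split => -[s w]; rewrite /D/= in_itv/=; [|case].
have mg : measurable_fun [set: measurableTypeR R * Omega] g.
  apply: (proj1 (measurable_restrictT _ mD)); apply/measurable_EFinP.
  apply: measurable_funS mf; last by move=> z /= /andP[].
  exact: measurable_nonneg_time.
rewrite [X in measurable_fun _ X](_ : _ = fine \o (fun w =>
    fubini_G lebesgue_measure g^\+ w - fubini_G lebesgue_measure g^\- w)%E).
  apply: measurableT_comp => //; apply: emeasurable_funB.
    apply: measurable_fun_fubini_tonelli_G => //.
    exact: measurable_funepos.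
  apply: measurable_fun_fubini_tonelli_G => //.
  exact: measurable_funeneg.
apply/funext => w /=; rewrite /Rintegral integral_mkcond integralE.
congr (fine (_ - _)%E); apply: eq_integral => s _.
- by rewrite !funeposE /g !patchE/= ; congr maxe; rewrite !mem_setE in_itv/=.
- by rewrite !funenegE /g !patchE/=; congr maxe; rewrite !mem_setE in_itv/=.
Qed.

(** * Regularity of the process *)

Lemma ler_coord_enorm {R : realType} {d : nat} (x : 'cV[R]_d) (i : 'I_d) :
  `|x i 0| <= enorm x.
Proof.
rewrite -sqrtr_sqr ler_wsqrtr// (bigD1 i)//= lerDl.
by apply: sumr_ge0 => j _; exact: sqr_ge0.
Qed.

Section diffusion_paths.
Context {R : realType} {dd : measure_display} {Omega : measurableType dd}
  {P : probability Omega R} {d : nat} {delta : R} {F : R -> set_system Omega}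
  {W : R -> Omega -> 'cV[R]_d} {sigma : R -> Omega -> 'M[R]_d}
  {b X : R -> Omega -> 'cV[R]_d}.
Hypothesis dX : diffusion P delta F W sigma b X.

Lemma diffusion_coord_measurable (t : R) (i : 'I_d) :
  0 <= t -> measurable_fun [set: Omega] (fun w => X t w i 0).
Proof.
move=> t0; have [M [Mad _ _] XE] := diffusion_eq dX.
under eq_fun do rewrite XE// !mxE.
apply: measurable_funD.
  move=> _ B mB; apply: (filtration_sub (diffusion_filtration dX) t0).
  by apply: (Mad t i 0 t0); exists B.
apply: (measurable_time_integral t (fun z => b z.1 z.2 i 0)).
exact: (diffusion_drift_measurable dX i 0).
Qed.

Lemma diffusion_drift_coord_integrable (T : R) (w : Omega) (i : 'I_d) :
  0 <= T ->
  lebesgue_measure.-integrable `[0, T] (EFin \o (fun s => b s w i 0)).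
Proof.
move=> T0; apply/integrableP; split.
  apply/measurable_EFinP.
  have mb := diffusion_drift_measurable dX i 0.
  apply: (@measurable_comp _ _ _ _ _ _
    [set z : measurableTypeR R * Omega | 0 <= (z.1 : R)]
    (fun z => b z.1 z.2 i 0) _ (fun s : measurableTypeR R => (s, w))).
  - exact: measurable_nonneg_time.
  - by move=> _ [s + <-]; rewrite /= in_itv/= => /andP[].
  - exact: mb.
  - by apply: measurable_funTS; exact: pair2_measurable.
apply: le_lt_trans (diffusion_drift_integrable dX w T0).
rewrite integral_mkcond [leRHS]integral_mkcond.
apply: ge0_le_integral_pointwise => s; rewrite !patchE; case: ifP => //= _.
by rewrite lee_fin ler_coord_enorm.
Qed.

Lemma diffusion_coord_continuous (T : R) (w : Omega) (i : 'I_d) :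
  0 <= T -> {within `[0, T], continuous (fun t => X t w i 0)}.
Proof.
move=> T0; have [M [_ cM _] XE] := diffusion_eq dX.
apply/subspace_continuousP => t tT.
have t0 : 0 <= t by move: tT; rewrite /= in_itv/= => /andP[].
have cI := parameterized_integral_continuous T0
  (diffusion_drift_coord_integrable _ w i T0).
have cMT : {within `[0, T], continuous (fun t => M t w)}.
  by apply: continuous_subspaceW (cM w) => s /=; rewrite in_itv/= => /andP[].
change (X s w i 0 @[s --> within `[0, T] (nbhs t)] --> X t w i 0).
rewrite XE// !mxE; apply: cvg_trans (cvgD
    (cvg_comp _ _ ((subspace_continuousP _ _).1 cMT t tT) (@coord_continuous _ _ _ i 0 _))
    ((subspace_continuousP _ _).1 cI t tT)).
apply: near_eq_cvg; rewrite near_withinE; near=> s.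
by rewrite /= in_itv/= => /andP[s0 _]; rewrite XE// !mxE.
Unshelve. all: by end_near. Qed.

End diffusion_paths.

(** * Exit times *)

Section exit_time.
Context {R : realType} {Omega : Type} {d : nat} (X : R -> Omega -> 'cV[R]_d).

Lemma tau_ge0 (r : R) (x : 'cV[R]_d) (w : Omega) : (0 <= tau X r x w)%E.
Proof. by apply: le_ereal_inf_tmp => _ [t [t0 _] <-]; rewrite lee_fin. Qed.

Lemma tau_le_radius (s r : R) (x : 'cV[R]_d) (w : Omega) :
  0 <= s -> s <= r -> (tau X s x w <= tau X r x w)%E.
Proof.
move=> s0 sr; apply: ereal_inf_le_tmp => _ [t [t0 nC] <-]; exists t => //; split=> //.
apply: contra_not nC => -[/= /andP[_ ts] xs]; split=> /=.
  by rewrite t0 (lt_le_trans ts)// lerXn2r// nnegrE (le_trans s0).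
exact: lt_le_trans xs sr.
Qed.

(** The time component leaves the cylinder at s ^+ 2, so tau_s <= s ^+ 2, with
    equality when the space component does not leave the ball earlier.  Squares
    replace the norm here because they are evidently continuous and measurable
    in the coordinates. *)
Lemma tau_eq_sqr (s : R) (w : Omega) : 0 < s ->
  tau X s 0 w = (s ^+ 2)%:E <->
  (forall t, 0 <= t < s ^+ 2 -> \sum_(i < d) X t w i 0 ^+ 2 < s ^+ 2).
Proof.
move=> s0.
have normE t : (enorm (0 + X t w) < s) = (\sum_(i < d) X t w i 0 ^+ 2 < s ^+ 2).
  by rewrite add0r /enorm -(ltr_sqrt _ (exprn_gt0 2 s0)) sqrtr_sqr gtr0_norm.
split=> [tauE t /andP[t0 ts]|inB].
- apply: contraT => tB; suff : (tau X s 0 w <= t%:E)%E.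
    by rewrite tauE lee_fin leNgt ts.
  apply: ereal_inf_lbound; exists t => //; split=> // -[_].
  by rewrite /eball/= normE; exact/negP.
- apply/eqP; rewrite eq_le; apply/andP; split.
    apply: ereal_inf_lbound; exists (s ^+ 2) => //; split; first exact: sqr_ge0.
    by move=> -[/=]; rewrite ltxx andbF.
  apply: le_ereal_inf_tmp => _ [t [t0 nC] <-]; rewrite lee_fin leNgt.
  apply/negP => ts; apply: nC; split=> /=; first by rewrite t0.
  by rewrite /eball/= normE inB// t0.
Qed.

End exit_time.

Lemma measurable_tau_eq_sqr {R : realType} {dd : measure_display}
    {Omega : measurableType dd} {P : probability Omega R} {d : nat} {delta : R}
    {F : R -> set_system Omega} {W : R -> Omega -> 'cV[R]_d}
    {sigma : R -> Omega -> 'M[R]_d} {b X : R -> Omega -> 'cV[R]_d} {s : R} :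
  diffusion P delta F W sigma b X -> 0 < s ->
  measurable [set w | tau X s 0 w = (s ^+ 2)%:E].
Proof.
move=> dX s0.
rewrite (_ : [set w | _] = [set w | forall t, 0 <= t < s ^+ 2 ->
    \sum_(i < d) X t w i 0 ^+ 2 < s ^+ 2]); last first.
  by apply/seteqP; split=> w /=; rewrite tau_eq_sqr.
apply: measurable_forall_lt => [t t0|w].
  by apply: measurable_sum => i; apply: measurable_funX;
    exact: diffusion_coord_measurable dX _ _ t0.
have cX i := diffusion_coord_continuous dX _ w i (sqr_ge0 s).
move=> t; apply: cvg_big => [|i _]; first exact: add_continuous.
by apply: cvgM; exact: cX.
Qed.

(** The quantity that bbar r * r dominates is a power of a norm. *)
Lemma drift_bound_bbar_ge0 {R : realType} {Omega : Type} {d : nat} {p0 q0 : R}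
    {b X : R -> Omega -> 'cV[R]_d} {h : R -> 'cV[R]_d -> R} {bbar : R -> R}
    {r : R} :
  drift_bound p0 q0 b X h bbar -> 0 < r -> 0 <= bbar r.
Proof.
move=> dB r0; rewrite -(pmulr_lge0 _ r0) -lee_fin.
exact: le_trans (poweR_ge0 _ _) (drift_bound_norm dB 0 0 r0).
Qed.

(** * Lower bounds for the mean and the discounted mean exit time *)

(** On [0, T[ the discount factor is at least its value at T. *)
Lemma integral_upto_ge {R : realType} {T lambda : R} {s : \bar R} :
  0 <= T -> 0 <= lambda -> (T%:E <= s)%E ->
  ((expR (- (lambda * T)) * T)%:E <=
     integral_upto s (fun t => expR (- (lambda * t))))%E.
Proof.
move=> T0 l0 Ts; rewrite /integral_upto integral_mkcond EFinM.
have muT : lebesgue_measure (`[0, T[ : set R) = T%:E.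
  rewrite lebesgue_measure_itv/= lte_fin sube0; case: ltP => // Tle0.
  by congr EFin; apply/eqP; rewrite eq_le T0.
rewrite -[in leLHS]muT; apply: ge0_le_integral_set => //.
- by move=> t; rewrite patchE; case: ifP => // _; rewrite lee_fin expR_ge0.
- move=> t /=; rewrite in_itv/= => /andP[t0 tT].
  rewrite patchE ifT; last first.
    by rewrite inE/=; split=> //; apply: lt_le_trans Ts; rewrite lte_fin.
  by rewrite lee_fin ler_expR lerN2 ler_wpM2l// ltW.
Qed.

Theorem corollary2p7 (R : realType) :
  exists N : R -> R -> R -> R -> R,
  forall (xibar : nat -> R -> R) (Nbar : nat -> R -> R -> R),
  universal_constants xibar Nbar ->
  forall (d : nat) (delta p0 q0 : R) (dd : measure_display)
    (Omega : measurableType dd) (P : probability Omega R)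
    (F : R -> set_system Omega) (W : R -> Omega -> 'cV[R]_d)
    (sigma : R -> Omega -> 'M[R]_d) (b X : R -> Omega -> 'cV[R]_d)
    (h : R -> 'cV[R]_d -> R) (bbar : R -> R) (Rlow Rbar Lambda : R),
  admissible_parameters d delta p0 q0 ->
  diffusion P delta F W sigma b X ->
  drift_bound p0 q0 b X h bbar ->
  0 < Rlow -> Nbar d p0 delta * bbar Rlow < 1 ->
  0 < Rbar -> 0 < Lambda ->
  forall r lambda : R, 0 < r <= Rbar -> 0 <= lambda <= Lambda ->
    ((r ^+ 2)%:E <=
       (N Rlow Rbar Lambda (xibar d delta))%:E * \int[P]_w tau X r 0 w)%E /\
    ((r ^+ 2)%:E <=
       (N Rlow Rbar Lambda (xibar d delta))%:E *
       \int[P]_w integral_upto (tau X r 0 w)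
                   (fun t => expR (- (lambda * t))))%E.
Proof.
exists (fun Rlow Rbar Lambda xi =>
  (1 + Rbar / Rlow) ^+ 2 * expR (Lambda * Rbar ^+ 2) / xi).
move=> xibar Nbar [xi01 _ _ [N1 [N2 est]]] d delta p0 q0 dd Omega P F W sigma b X.
move=> h bbar Rlow Rbar Lambda adm dX dB Rlow0 NbRlow Rbar0 Lambda0 r lambda.
move=> /andP[r0 rRbar] /andP[lambda0 lambdaL].
set xi := xibar d delta; set E := expR (Lambda * Rbar ^+ 2).
set K := 1 + Rbar / Rlow.
have xi0 : 0 < xi by case: adm => d2 d01 _ _ _; case/andP: (xi01 d delta d2 d01).
pose s := Num.min r Rlow.
have s0 : 0 < s by rewrite lt_min r0.
have sr : s <= r by rewrite ge_min lexx.
have sRlow : s <= Rlow by rewrite ge_min lexx orbT.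
have sqr_sr : s ^+ 2 <= r ^+ 2 by rewrite lerXn2r// nnegrE ltW.
have sqr_rRbar : r ^+ 2 <= Rbar ^+ 2 by rewrite lerXn2r// nnegrE ltW.
have rKs : r <= K * s.
  rewrite /K /s; case: (leP r Rlow) => _.
    by rewrite ler_peMl ?(ltW r0)// lerDl divr_ge0// ltW.
  by rewrite mulrDl mul1r divfK ?gt_eqF// (le_trans rRbar)// lerDr ltW.
(* If Nbar < 0, nonnegativity of bbar s replaces monotonicity. *)
have Nbs : Nbar d p0 delta * bbar s <= 1.
  have [Nb0|/ltW Nb0] := leP 0 (Nbar d p0 delta).
    apply: le_trans (ltW NbRlow); apply: ler_wpM2l => //.
    exact: (drift_bound_nondecreasing dB s0 sRlow).
  apply: le_trans (_ : 0 <= 1) => //; apply: mulr_le0_ge0 => //.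
  exact: drift_bound_bbar_ge0 dB s0.
have PA := exit_tau_ge (est _ _ _ _ _ _ _ _ _ _ _ _ _ _ adm dX dB s s0 Nbs).
have lower (f : Omega -> \bar R) : (forall w, 0 <= f w)%E ->
    (forall w, tau X s 0 w = (s ^+ 2)%:E -> (E^-1 * s ^+ 2)%:E <= f w)%E ->
    ((r ^+ 2)%:E <= (K ^+ 2 * E / xi)%:E * \int[P]_w f w)%E.
  move=> f0 fE.
  have c0 : 0 <= E^-1 * s ^+ 2 by rewrite mulr_ge0 ?sqr_ge0// invr_ge0 expR_ge0.
  have fint := ge0_le_integral_set (mu := P) (measurable_tau_eq_sqr dX s0) c0 f0 fE.
  have N0 : 0 <= K ^+ 2 * E / xi.
    by rewrite divr_ge0 ?(ltW xi0)// mulr_ge0 ?sqr_ge0// expR_ge0.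
  have le_int : ((K ^+ 2 * E / xi)%:E * ((E^-1 * s ^+ 2)%:E * xi%:E) <=
      (K ^+ 2 * E / xi)%:E * \int[P]_w f w)%E.
    apply: lee_wpmul2l; first by rewrite lee_fin.
    by apply: le_trans fint; apply: lee_wpmul2l; first by rewrite lee_fin.
  apply: le_trans le_int; rewrite -!EFinM lee_fin.
  have E0 : E != 0 by rewrite gt_eqF// expR_gt0.
  have -> : K ^+ 2 * E / xi * (E^-1 * s ^+ 2 * xi) = (K * s) ^+ 2.
    by field; rewrite E0 gt_eqF.
  by rewrite lerXn2r// nnegrE ?(le_trans _ rKs)// ltW.
have tau_ge w : tau X s 0 w = (s ^+ 2)%:E -> ((s ^+ 2)%:E <= tau X r 0 w)%E.
  by move=> <-; exact: tau_le_radius (ltW s0) sr.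
split; apply: lower => [w|w /tau_ge].
- exact: tau_ge0.
- apply: le_trans; rewrite lee_fin ler_piMl ?sqr_ge0// invf_le1 ?expR_gt0//.
  by rewrite -expR0 ler_expR mulr_ge0 ?sqr_ge0// ltW.
- by apply: integral_ge0 => t _; rewrite lee_fin expR_ge0.
- move=> /(integral_upto_ge (sqr_ge0 s) lambda0); apply: le_trans.
  rewrite lee_fin ler_wpM2r ?sqr_ge0// -expRN ler_expR lerN2.
  by rewrite ler_pM ?sqr_ge0// (le_trans sqr_sr).
Qed.
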